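(* Let $X$ be a Hilbert space, $C$ a nonempty closed convex bounded subset of $X$, $U:C\to C$ a nonexpansive mapping, and $u\in C$. Let $\lambda_n:=\frac{1}{n+1}$ and define $(u_n)_{n\in\mathbb{N}}$ by $u_0:=u$, $u_{n+1}:=\lambda_{n+1}u_0+(1-\lambda_{n+1})U(u_n)$. Let $b\in\mathbb{N}$, $b\geq 1$, be an upper bound on the diameter of $C$. Then, for all $k\in\mathbb{N}$ and every monotone function $f:\mathbb{N}\to\mathbb{N}$, $$\exists N\leq\phi_b(k,f)\ \forall i,j\in[N,f(N)]\ \left(\|u_i-u_j\|<\frac{1}{k+1}\right),$$ where $$\phi_b(k,f):=\sigma'\left(2k+1,\ \psi\left(48(k+1)^2-1,\ \overline{f}\right)\right),\qquad \overline{f}(m):=36b(k+1)^2\left(f(\sigma'(2k+1,m))+1\right)-1,$$ and $\sigma'$, $\psi$ are the functions defined in the context.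
   Context: $\mathbb{N}=\{0,1,2,\ldots\}$. For $n,m\in\mathbb{N}$, $[n,m]:=\{n,n+1,\ldots,m\}$ (empty if $m<n$). A map $U$ is nonexpansive if $\|U(x)-U(y)\|\leq\|x-y\|$ for all $x,y$. A function $f:\mathbb{N}\to\mathbb{N}$ is monotone if $k\leq n$ implies $f(k)\leq f(n)$. For $g:\mathbb{N}\to\mathbb{N}$, $g^{(n)}$ is the $n$-fold composition of $g$ with itself. Definitions (depending on $b$): - $r:\mathbb{N}\to\mathbb{N}$, $r(k):=b^4(k+1)^2+b^2$. - For $g:\mathbb{N}\to\mathbb{N}$: $\omega_g:\mathbb{N}\to\mathbb{N}$, $\omega_g(m):=\max\{g(12b(m+1)^2),\,12b(m+1)^2\}+1$. - For $k\in\mathbb{N}$, $g:\mathbb{N}\to\mathbb{N}$: $\gamma_{k,g}:\mathbb{N}\to\mathbb{N}$, $\gamma_{k,g}(m):=\max\{g(m),\,2b(k+1)\}$. - For $g:\mathbb{N}\to\mathbb{N}$: $\widehat{g}(m):=g(16b^2(m+1)^2+8b(m+1))$. - $\psi(k,g):=16b^2\left(12b\left(\omega_{\gamma_{k,\widehat{g}}}^{(r(2k+1))}(0)+1\right)^2+1\right)^2+8b\left(12b\left(\omega_{\gamma_{k,\widehat{g}}}^{(r(2k+1))}(0)+1\right)^2+1\right)$. - $\sigma'(k,n):=\left\lceil\exp\left(\tilde n+1+\lceil\ln(3b^2(k+1)^2)\rceil\right)\right\rceil$, with $\tilde n:=\max\{n,\,6b^2(k+1)^2\}$. *)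

(* Defs.v *)
From HB Require Import structures.
From mathcomp Require Import all_boot all_order all_algebra.
From mathcomp Require Import sesquilinear.
From mathcomp Require Import all_classical all_reals all_analysis.
From mathcomp Require Import complex.

Set Implicit Arguments.
Unset Strict Implicit.
Unset Printing Implicit Defensive.

Import Order.TTheory GRing.Theory Num.Theory.
Import numFieldNormedType.Exports.
Local Open Scope ring_scope.

(* A Hilbert space is real or complex.  In the complex case, norms take their
   values in R[i], where [x <= y] means that [y - x] is a nonnegative real; in
   particular the scalars in [0, 1] are the usual real ones. *)
Variant scalar_kind := RealScalars | ComplexScalars.

Definition scalars (R : realType) (s : scalar_kind) : numFieldType :=
  match s with
  | RealScalars => R
  | ComplexScalars => R[i]%C
  end.

Definition scalars_conj (R : realType) (s : scalar_kind) :
    scalars R s -> scalars R s :=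
  match s return scalars R s -> scalars R s with
  | RealScalars => idfun
  | ComplexScalars => @conjc R
  end.

Definition nonexpansive_on (K : numFieldType) (X : normedModType K)
    (C : set X) (U : X -> X) : Prop :=
  forall x y, C x -> C y -> `|U x - U y| <= `|x - y|.

Definition halpern_lambda (K : numFieldType) (n : nat) : K := 1 / n.+1%:R.

Fixpoint halpern (K : numFieldType) (X : lmodType K) (U : X -> X) (u : X)
    (n : nat) : X :=
  match n with
  | 0 => u
  | n'.+1 => halpern_lambda K n *: u
             + (1 - halpern_lambda K n) *: U (halpern U u n')
  end.

Section Bounds.
Local Open Scope nat_scope.

Definition r_ (b k : nat) : nat := b ^ 4 * k.+1 ^ 2 + b ^ 2.

Definition omega_ (b : nat) (g : nat -> nat) (m : nat) : nat :=
  (maxn (g (12 * b * m.+1 ^ 2)) (12 * b * m.+1 ^ 2)).+1.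

Definition gamma_ (b k : nat) (g : nat -> nat) (m : nat) : nat :=
  maxn (g m) (2 * b * k.+1).

Definition hat_ (b : nat) (g : nat -> nat) (m : nat) : nat :=
  g (16 * b ^ 2 * m.+1 ^ 2 + 8 * b * m.+1).

Definition psi_ (b k : nat) (g : nat -> nat) : nat :=
  let w := iter (r_ b (2 * k + 1)) (omega_ b (gamma_ b k (hat_ b g))) 0 in
  16 * b ^ 2 * (12 * b * w.+1 ^ 2 + 1) ^ 2 + 8 * b * (12 * b * w.+1 ^ 2 + 1).

(* The value does not depend on the choice of the model [R] of the reals.  For
   [0 < b] the ceiling is that of a positive real, so that [absz] is only a
   conversion from [int] to [nat]. *)
Definition sigma_ (R : realType) (b k n : nat) : nat :=
  let n' := maxn n (6 * b ^ 2 * k.+1 ^ 2) in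
  absz (Num.ceil (expR
    (n'%:R + 1 + (Num.ceil (ln ((3 * b ^ 2 * k.+1 ^ 2)%:R : R)))%:~R : R)%R)).

(* Here and in [phi_] the truncated subtraction of 1 is exact, since its first
   argument is positive when [0 < b]. *)
Definition overline_ (R : realType) (b k : nat) (f : nat -> nat) (m : nat) :
    nat :=
  36 * b * k.+1 ^ 2 * (f (sigma_ R b (2 * k + 1) m) + 1) - 1.

Definition phi_ (R : realType) (b k : nat) (f : nat -> nat) : nat :=
  sigma_ R b (2 * k + 1) (psi_ b (48 * k.+1 ^ 2 - 1) (overline_ R b k f)).

End Bounds.

(* Main.v *)
Require Import Defs.
From HB Require Import structures.
From mathcomp Require Import all_boot all_order all_algebra.
From mathcomp Require Import sesquilinear.
From mathcomp Require Import all_classical all_reals all_analysis.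
From mathcomp Require Import ring lra zify complex.

Set Implicit Arguments.
Unset Strict Implicit.
Unset Printing Implicit Defensive.

Import Order.TTheory GRing.Theory Num.Theory.
Import numFieldNormedType.Exports.
Local Open Scope classical_set_scope.
Local Open Scope ring_scope.

(* Wittmann's argument without weak compactness.  Instead of projecting [u] onto
   the fixed points of [U], take a point [x] that minimizes the distance to [u]
   up to an error, among the points moved by [U] by at most [1/(w i + 1)], while
   [x] itself is moved by at most [1/(w i.+1 + 1)], where [w] iterates [omega_].
   Such [i] and [x] exist with [i < r_ b _]: otherwise the squared distance, at
   most [b^2], could be decreased too often.  Comparing [x] with the points of
   the segment from [x] to an approximate fixed point [y] bounds the inner
   product of [u - x] and [y - x].  The iterates are approximate fixed points
   from an explicit rank on, so this applies to [y = u_n], and the usual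
   recursive inequality for [|u_n - x|^2] brings the iterates close to [x]. *)

(** * Approximate minimization over a chain of levels *)

(** If every level failed, a point of [S i.+1] could always be replaced by a point of [S i] with
    [phi] smaller by more than [eps]; [r] replacements would bring [phi] from at most [B] to below
    [0]. *)
Lemma approximate_minimizer (R : realFieldType) (X : Type)
    (S : nat -> X -> Prop) (phi : X -> R) (B eps : R) (r : nat) :
  (exists x, S r x) -> (forall i x, S i x -> 0 <= phi x <= B) ->
  B < r%:R * eps ->
  exists i x, [/\ (i < r)%N, S i.+1 x &
    forall y, S i y -> phi x <= phi y + eps].
Proof.
move=> [xr Sxr] phiB rB; apply: contrapT => noex.
have descent j : (j <= r)%N ->
    exists x, S (r - j)%N x /\ phi x <= B - j%:R * eps.
  elim: j => [_|j IHj jr].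
    exists xr; rewrite subn0 mul0r subr0; split=> //.
    by have /andP[] := phiB _ _ Sxr.
  have [x [Sx phix]] := IHj (ltnW jr).
  have [y [Sy phiy]] : exists y, S (r - j.+1)%N y /\ phi y < phi x - eps.
    apply: contrapT => noy; apply: noex; exists (r - j.+1)%N, x; split.
    - lia.
    - by rewrite -subSn// subSS.
    - move=> y Sy; rewrite leNgt; apply/negP => phiy.
      by apply: noy; exists y; split=> //; rewrite ltrBrDr.
  by exists y; split=> //; rewrite -natr1; lra.
have [x [Sx phix]] := descent r (leqnn r).
by have /andP[phi0 _] := phiB _ _ Sx; lra.
Qed.

(** * Halpern iteration in a metric setting: asymptotic regularity *)

Section Halpern.
Variables (R : realFieldType) (X : Type).
(* [W t x y] stands for [(1 - t) x + t y]; only the metric, CAT(0) properties of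
   a Hilbert space are used, where [W_CN] holds with equality. *)
Variables (d : X -> X -> R) (W : R -> X -> X -> X).
Hypothesis d_ge0 : forall x y, 0 <= d x y.
Hypothesis d_xx : forall x, d x x = 0.
Hypothesis dC : forall x y, d x y = d y x.
Hypothesis d_triangle : forall x y z, d x z <= d x y + d y z.
Hypothesis W_CN : forall z (t : R) x y, 0 <= t <= 1 ->
  d z (W t x y) ^+ 2 <=
  (1 - t) * d z x ^+ 2 + t * d z y ^+ 2 - t * (1 - t) * d x y ^+ 2.
Hypothesis W_contract : forall (t : R) x y z, 0 <= t <= 1 ->
  d (W t x z) (W t y z) <= (1 - t) * d x y.
Hypothesis W_lipschitz : forall (s t : R) x y, 0 <= s <= t -> t <= 1 ->
  d (W s x y) (W t x y) <= (t - s) * d x y.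

Variables (C : X -> Prop) (U : X -> X) (u : X) (b : nat).
Hypothesis C_W : forall (t : R) x y, 0 <= t <= 1 -> C x -> C y -> C (W t x y).
Hypothesis C_diam : forall x y, C x -> C y -> d x y <= b%:R.
Hypothesis U_C : forall x, C x -> C (U x).
Hypothesis U_nonexpansive : forall x y, C x -> C y -> d (U x) (U y) <= d x y.
Hypothesis b_gt0 : (0 < b)%N.

Variable v : nat -> X.
Hypothesis v0 : v 0 = u.
Hypothesis vS : forall n, v n.+1 = W (n.+2%:R^-1) (U (v n)) u.
Hypothesis uC : C u.

Let b_ge1 : 1 <= b%:R :> R.
Proof. by rewrite ler1n. Qed.

Let invn01 n : 0 <= (n.+1%:R^-1 : R) <= 1.
Proof. by rewrite invr_ge0 ler0n invf_le1 ?ler1n ?ltr0n. Qed.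

Lemma halpern_in n : C (v n).
Proof.
elim: n => [|n IHn]; first by rewrite v0.
by rewrite vS; apply: C_W => //; exact: U_C.
Qed.

(** With [z := x] the right side of [W_CN] collapses to [(t * d x y) ^+ 2]. *)
Lemma W_dist_left t x y : 0 <= t <= 1 -> d x (W t x y) <= t * d x y.
Proof.
move=> t01; have /andP[t0 _] := t01.
rewrite -(ler_pXn2r (n := 2)) ?nnegrE ?mulr_ge0//.
by apply: le_trans (W_CN x x y t01) _; rewrite d_xx; lra.
Qed.

Lemma W_dist_right t x y : 0 <= t <= 1 -> d y (W t x y) <= (1 - t) * d x y.
Proof.
move=> t01; have /andP[_ t1] := t01.
rewrite -(ler_pXn2r (n := 2)) ?nnegrE ?mulr_ge0 ?subr_ge0//.
by apply: le_trans (W_CN y x y t01) _; rewrite d_xx (dC y); lra.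
Qed.

(* AM-GM: 1/(n+2) <= 1/q + q/(n+2)^2, and the last term telescopes. *)
Lemma halpern_step_bound (q : R) n : 0 < q ->
  n.+2%:R * d (v n.+1) (v n) <=
  b%:R * (1 + n%:R / q + q * (1 - n.+1%:R^-1)).
Proof.
move=> q0; elim: n => [|n IHn].
  have := W_dist_right (U (v 0)) u (invn01 1); have := C_diam (U_C uC) uC.
  rewrite vS v0 (dC (W _ _ _)) => Uu_b; have := d_ge0 (U u) u.
  by rewrite invr1 subrr mulr0 mul0r !addr0 mulr1; lra.
have n2 : 0 < n.+2%:R :> R by [].
have n3 : 0 < n.+3%:R :> R by [].
have inv_le : n.+3%:R^-1 <= n.+2%:R^-1 :> R by rewrite lef_pV2 ?posrE// ler_nat.
(* The intermediate point has the weight of the later step and the iterate of the earlier one, which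
   separates the two changes. *)
have step : d (v n.+2) (v n.+1) <= (1 - n.+3%:R^-1) * d (v n.+1) (v n)
    + (n.+2%:R^-1 - n.+3%:R^-1) * b%:R.
  rewrite (vS n.+1) {2}(vS n).
  apply: le_trans (d_triangle _ (W n.+3%:R^-1 (U (v n)) u) _) _.
  apply: lerD.
    apply: le_trans (W_contract _ _ _ (invn01 n.+2)) _.
    rewrite ler_wpM2l ?subr_ge0 ?invf_le1 ?ler1n//.
    by apply: U_nonexpansive; exact: halpern_in.
  have /andP[n3_ge0 _] := invn01 n.+2; have /andP[_ n2_le1] := invn01 n.+1.
  apply: le_trans (W_lipschitz _ _ _ n2_le1) _; first by rewrite n3_ge0.
  by rewrite ler_wpM2l ?subr_ge0// C_diam//; apply/U_C/halpern_in.
have AMGM : n.+2%:R^-1 <= q^-1 + q * (n.+1%:R^-1 - n.+2%:R^-1) :> R.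
  rewrite -[n.+2%:R in leRHS]natr1 -[n.+2%:R in leLHS]natr1.
  have m0 : 0 < n.+1%:R :> R by [].
  move: (n.+1%:R) m0 => m m0.
  rewrite -subr_ge0.
  have -> : q^-1 + q * (m^-1 - (m + 1)^-1) - (m + 1)^-1 =
    (m * (m + 1) + q ^+ 2 - q * m) / (q * m * (m + 1)).
    by field; apply/and3P; split; lra.
  by apply: divr_ge0; nra.
(* The factor [n+3] turns the coefficient [1 - 1/(n+3)] into [n+2], as in the induction hypothesis,
   and the second term into [b/(n+2)]. *)
have {}step := ler_wpM2l (ltW n3) step.
apply: le_trans step _.
have -> : n.+3%:R * ((1 - n.+3%:R^-1) * d (v n.+1) (v n)
    + (n.+2%:R^-1 - n.+3%:R^-1) * b%:R)
    = n.+2%:R * d (v n.+1) (v n) + n.+2%:R^-1 * b%:R :> R.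
  rewrite -[n.+3%:R]natr1; field.
  by have n0 : 0 <= n%:R :> R by []; apply/andP; split; rewrite gt_eqF; lra.
rewrite -[n.+1%:R in leRHS]natr1.
have := ler_wpM2l (ltW (lt_le_trans ltr01 b_ge1)) AMGM.
move: (n.+2%:R^-1) (n.+1%:R^-1) (n.+2%:R * _) IHn => s t a; lra.
Qed.

(** [d (U (v n)) (v n)] exceeds the last step by at most [b/(n+2)]. Taking [q = 2 * b * M] keeps the
    part of the step bound that grows with [n] below half of the allowed [(n+2)/M]; the size of [n]
    absorbs the remaining [2 * b + 2 * b^2 * M]. *)
Lemma halpern_asymptotic_regularity m n :
  (16 * b ^ 2 * m.+1 ^ 2 + 8 * b * m.+1 <= n)%N ->
  d (U (v n)) (v n) <= m.+1%:R^-1.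
Proof.
set M := m.+1 => nM.
have q0 : 0 < 2 * b%:R * M%:R :> R by rewrite !mulr_gt0 ?ltr0n.
have b0 : 0 < b%:R :> R by rewrite ltr0n.
have M0 : 0 < M%:R :> R by rewrite ltr0n.
have n2 : 0 < n.+2%:R :> R by [].
have step := halpern_step_bound n q0.
have last_step : d (v n.+1) (U (v n)) <= n.+2%:R^-1 * b%:R.
  rewrite vS dC; apply: le_trans (W_dist_left _ _ (invn01 n.+1)) _.
  by rewrite ler_wpM2l ?invr_ge0 ?ler0n// C_diam//; apply/U_C/halpern_in.
have {}last_step : n.+2%:R * d (v n.+1) (U (v n)) <= b%:R.
  by rewrite mulrC -ler_pdivlMr// mulrC.
have tri : d (U (v n)) (v n) <= d (v n.+1) (U (v n)) + d (v n.+1) (v n).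
  by rewrite (dC _ (U _)); exact: d_triangle.
rewrite -[leRHS]mulr1 mulrC ler_pdivlMr//.
rewrite -(ler_pM2l n2) mulr1 mulrA.
have {}step : n.+2%:R * d (v n.+1) (v n) <=
    b%:R + n%:R / (2 * M%:R) + 2 * b%:R ^+ 2 * M%:R.
  apply: le_trans step _.
  have -> : b%:R * (1 + n%:R / (2 * b%:R * M%:R)
      + 2 * b%:R * M%:R * (1 - n.+1%:R^-1))
      = b%:R + n%:R / (2 * M%:R)
        + 2 * b%:R ^+ 2 * M%:R * (1 - n.+1%:R^-1) :> R.
    by move: (n.+1%:R^-1) => s; field; rewrite !gt_eqF.
  by rewrite lerD2l ler_piMr ?gerBl ?invr_ge0 ?mulr_ge0 ?exprn_ge0 ?ler0n.
have {}tri : n.+2%:R * d (U (v n)) (v n) <=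
    2 * b%:R + n%:R / (2 * M%:R) + 2 * b%:R ^+ 2 * M%:R.
  by have := ler_wpM2l (ltW n2) tri; rewrite mulrDr; lra.
apply: le_trans (ler_wpM2r (ltW M0) tri) _.
have -> : (2 * b%:R + n%:R / (2 * M%:R) + 2 * b%:R ^+ 2 * M%:R) * M%:R =
    2 * b%:R * M%:R + n%:R / 2 + 2 * b%:R ^+ 2 * M%:R ^+ 2 :> R.
  by field; rewrite gt_eqF.
have : (16 * b ^ 2 * M ^ 2 + 8 * b * M)%:R <= n%:R :> R by rewrite ler_nat.
rewrite natrD !(natrX, natrM) -[n.+2%:R]natr1 -[n.+1%:R]natr1.
have : 0 <= b%:R * M%:R :> R by rewrite mulr_ge0 ?ler0n.
have : 0 <= b%:R ^+ 2 * M%:R ^+ 2 :> R by rewrite mulr_ge0 ?exprn_ge0 ?ler0n.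
by lra.
Qed.

(** * Approximate projection of [u] onto the fixed points *)

(** [U z] lies within [t * D + e] of [x] and [(1 - t) * D + e] of [y], so [W_CN] puts it close to
    [z]: the terms in [D^2] cancel, and [4 * t * (1 - t) * D * e + e^2] remains. *)
Lemma W_approximate_fixpoint (e : R) t x y : C x -> C y -> 0 <= t <= 1 ->
  d (U x) x <= e -> d (U y) y <= e ->
  d (U (W t x y)) (W t x y) ^+ 2 <= b%:R * e + e ^+ 2.
Proof.
move=> Cx Cy t01 Ux Uy; set z := W t x y; set D := d x y.
have /andP[t0 t1] := t01.
have Cz : C z by exact: C_W.
have D0 : 0 <= D by exact: d_ge0.
have Db : D <= b%:R by exact: C_diam.
have e0 : 0 <= e by exact: le_trans (d_ge0 _ _) Ux.
have Pd : d (U z) x <= t * D + e.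
  apply: le_trans (d_triangle _ (U x) _) (lerD _ Ux).
  apply: le_trans (U_nonexpansive Cz Cx) _.
  by rewrite dC; exact: W_dist_left.
have Qd : d (U z) y <= (1 - t) * D + e.
  apply: le_trans (d_triangle _ (U y) _) (lerD _ Uy).
  apply: le_trans (U_nonexpansive Cz Cy) _.
  by rewrite dC; exact: W_dist_right.
have Pd2 : d (U z) x ^+ 2 <= (t * D + e) ^+ 2.
  by rewrite ler_pXn2r ?nnegrE ?d_ge0// addr_ge0 ?mulr_ge0.
have Qd2 : d (U z) y ^+ 2 <= ((1 - t) * D + e) ^+ 2.
  by rewrite ler_pXn2r ?nnegrE ?d_ge0// addr_ge0 ?mulr_ge0 ?subr_ge0.
apply: le_trans (W_CN _ _ _ t01) _.
have t1' : 0 <= 1 - t by rewrite subr_ge0.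
apply: le_trans (lerB (lerD (ler_wpM2l t1' Pd2) (ler_wpM2l t0 Qd2)) (lexx _)) _.
have -> : (1 - t) * (t * D + e) ^+ 2 + t * ((1 - t) * D + e) ^+ 2
    - t * (1 - t) * D ^+ 2 = (1 - (2 * t - 1) ^+ 2) * (D * e) + e ^+ 2 by ring.
rewrite lerD2r; apply: (@le_trans _ _ (D * e)); last exact: ler_wpM2r.
by rewrite ler_piMl ?mulr_ge0// gerBl sqr_ge0.
Qed.

(** Through [W_CN], near-minimality of [x] against [z = W t x y] gives
    [t * Q <= t^2 * d x y^2 + eps], where [Q] is the quantity to bound, [2 <u - x, y - x>] in a
    Hilbert space. *)
Lemma quantitative_projection (L : nat) (w : nat -> nat) : (0 < L)%N ->
  (forall i, 12 * b * (w i).+1 ^ 2 <= w i.+1)%N ->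
  exists i x, [/\ (i < b ^ 4 * (2 * L) ^ 2 + b ^ 2)%N, C x,
    d (U x) x <= (w i.+1).+1%:R^-1 &
    forall y, C y -> d (U y) y <= (12 * b * (w i).+1 ^ 2).+1%:R^-1 ->
      d u x ^+ 2 + d x y ^+ 2 - d u y ^+ 2 <= L%:R^-1].
Proof.
move=> L0 w_step.
have b0 : 0 < b%:R :> R by rewrite ltr0n.
have l0 : 0 < L%:R :> R by rewrite ltr0n.
have b2 : 1 <= b%:R ^+ 2 :> R by rewrite exprn_ege1.
(* These values satisfy [t^2 * b^2 = eps = t / (2 * L)], and the number of levels times [eps] is
   [b^2 + 1 / (4 * L^2)], just above the bound [b^2] on the squared distance. *)
pose eps : R := (4 * b%:R ^+ 2 * L%:R ^+ 2)^-1.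
pose t : R := (2 * b%:R ^+ 2 * L%:R)^-1.
have l1 : 1 <= L%:R :> R by rewrite ler1n.
have t0 : 0 < t by rewrite invr_gt0 !mulr_gt0// exprn_gt0.
have t01 : 0 <= t <= 1 by rewrite ltW//= invf_le1 ?mulr_gt0 ?exprn_gt0//; nra.
have [||| i [x [ir [Cx Ux] minx]]] := @approximate_minimizer R X
  (fun i x => C x /\ d (U x) x <= (w i).+1%:R^-1) (fun x => d u x ^+ 2)
  (b%:R ^+ 2) eps (b ^ 4 * (2 * L) ^ 2 + b ^ 2).
- exists (v (16 * b ^ 2 * (w (b ^ 4 * (2 * L) ^ 2 + b ^ 2)%N).+1 ^ 2
             + 8 * b * (w (b ^ 4 * (2 * L) ^ 2 + b ^ 2)%N).+1)).
  by split; [exact: halpern_in | exact: halpern_asymptotic_regularity].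
- move=> _ x [Cx _]; rewrite sqr_ge0 /=.
  by rewrite ler_pXn2r ?nnegrE ?ler0n// C_diam.
- rewrite natrD !(natrX, natrM) /eps.
  have -> : (b%:R ^+ 4 * (2 * L%:R) ^+ 2 + b%:R ^+ 2) *
      (4 * b%:R ^+ 2 * L%:R ^+ 2)^-1 =
      b%:R ^+ 2 + (4 * L%:R ^+ 2)^-1 :> R.
    by field; rewrite !gt_eqF.
  by rewrite ltrDl invr_gt0 mulr_gt0 ?exprn_gt0.
exists i, x; split=> // y Cy Uy.
pose z := W t x y.
(* Both [x] and [y] are moved by at most [e], and [b * e + e^2 <= 2 * b * e] is one sixth of
   [1 / (w i + 1)^2]; hence [z] competes with [x]. *)
pose e : R := (12 * b%:R * (w i).+1%:R ^+ 2)^-1.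
have w1 : 1 <= (w i).+1%:R :> R by rewrite ler1n.
have w2 : 1 <= (w i).+1%:R ^+ 2 :> R by rewrite exprn_ege1.
have eE : e = (12 * b * (w i).+1 ^ 2)%:R^-1 by rewrite !(natrX, natrM).
have p0 : (0 < 12 * b * (w i).+1 ^ 2)%N by rewrite !muln_gt0 b_gt0.
have eb : d (U z) z ^+ 2 <= b%:R * e + e ^+ 2.
  apply: W_approximate_fixpoint => //; rewrite eE.
    apply: le_trans Ux _.
    by rewrite lef_pV2 ?posrE ?ltr0n// ler_nat ltnW// ltnS.
  by apply: le_trans Uy _; rewrite lef_pV2 ?posrE ?ltr0n// ler_nat ltnW.
have e0 : 0 <= e by rewrite eE invr_ge0 ler0n.
have e1 : e <= 1 by rewrite eE invf_le1 ?ltr0n// ler1n.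
have Uz : d (U z) z <= (w i).+1%:R^-1.
  rewrite -(ler_pXn2r (n := 2)) ?nnegrE ?d_ge0 ?invr_ge0//.
  apply: le_trans eb _; apply: (@le_trans _ _ (2 * (b%:R * e))).
    by rewrite mulr2n; nra.
  rewrite /e.
  have -> : 2 * (b%:R * (12 * b%:R * (w i).+1%:R ^+ 2)^-1) =
     6^-1 * (w i).+1%:R^-1 ^+ 2 :> R.
    by move: (w i).+1%:R w1 => W1 w1; field; rewrite !gt_eqF//; lra.
  by rewrite ler_piMl ?sqr_ge0//; lra.
have Cz : C z by exact: C_W.
have /= phix := minx z (conj Cz Uz).
have CN := W_CN u x y t01; rewrite -/z in CN.
have D2 : d x y ^+ 2 <= b%:R ^+ 2 by rewrite ler_pXn2r ?nnegrE ?ler0n// C_diam.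
rewrite -(ler_pM2l t0); apply: (@le_trans _ _ (t ^+ 2 * b%:R ^+ 2 + eps)).
  by have := ler_wpM2l (sqr_ge0 t) D2; lra.
suff -> : t ^+ 2 * b%:R ^+ 2 + eps = t / L%:R by [].
by rewrite /t /eps; field; rewrite !gt_eqF.
Qed.

(** * Distance of the iterates to [x], and metastability *)

(* The last hypothesis reads [2 <u - x, v n.+1 - x> <= c] in a Hilbert space. *)
Lemma halpern_recursion x (e c : R) n : C x -> d (U x) x <= e -> e <= b%:R ->
  d u x ^+ 2 + d x (v n.+1) ^+ 2 - d u (v n.+1) ^+ 2 <= c ->
  d (v n.+1) x ^+ 2 <=
  (1 - n.+2%:R^-1) * d (v n) x ^+ 2 + n.+2%:R^-1 * c + 3 * b%:R * e.
Proof.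
move=> Cx Ux eb cx.
have := invn01 n.+1; move: (n.+2%:R^-1) (vS n) => l vSn l01.
have /andP[l0 l1] := l01.
have Cv := halpern_in n.
have e0 : 0 <= e by exact: le_trans (d_ge0 _ _) Ux.
have B : d (U (v n)) x ^+ 2 <= d (v n) x ^+ 2 + 3 * b%:R * e.
  have : d (U (v n)) x <= d (v n) x + e.
    exact: le_trans (d_triangle _ (U x) _) (lerD (U_nonexpansive Cv Cx) Ux).
  have s0 := d_ge0 (v n) x; have sb := C_diam Cv Cx.
  rewrite -(ler_pXn2r (n := 2)) ?nnegrE ?d_ge0 ?addr_ge0// => /le_trans; apply.
  by have := ler_wpM2r e0 sb; have := ler_wpM2r e0 eb; lra.
have CN := W_CN x (U (v n)) u l01; rewrite -vSn in CN.
(* [cx] removes [d x u ^+ 2] from [CN] at the cost of [d u (v n.+1) ^+ 2], which by this bound the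
   negative term of [CN] absorbs. *)
have E : d u (v n.+1) ^+ 2 <= (1 - l) ^+ 2 * d (U (v n)) u ^+ 2.
  rewrite vSn -exprMn ler_pXn2r ?nnegrE ?d_ge0 ?mulr_ge0 ?d_ge0 ?subr_ge0//.
  exact: W_dist_right.
rewrite (dC x (v _)) (dC x (U _)) in CN; rewrite (dC u x) (dC x (v _)) in cx.
have l1' : 0 <= 1 - l by rewrite subr_ge0.
have := ler_wpM2l l1' B.
have := ler_wpM2l l0 cx; have := ler_wpM2l l0 E.
have : 0 <= l * d (v n.+1) x ^+ 2 by rewrite mulr_ge0 ?sqr_ge0.
have : 0 <= l ^+ 2 * (1 - l) * d (U (v n)) u ^+ 2.
  by rewrite !mulr_ge0 ?sqr_ge0.
have : 0 <= l * (3 * b%:R * e) by rewrite !mulr_ge0 ?ler0n.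
move: CN; move: (d (v n.+1) x ^+ 2) (d x u ^+ 2) (d (U (v n)) x ^+ 2)
  (d (U (v n)) u ^+ 2) (d u (v n.+1) ^+ 2) (d (v n) x ^+ 2) => S A P D F T.
by lra.
Qed.

(** Starting from the crude bound [b^2] at rank [m], the factors [1 - 1/(j+2)] telescope to
    [(m+1)/(n+1)], the terms in [c] have total weight at most [1], and the errors add up. *)
Lemma halpern_dist_bound x (e c : R) m n : C x -> d (U x) x <= e ->
  e <= b%:R -> 0 <= c -> (m <= n)%N ->
  (forall j, (m < j)%N ->
     d u x ^+ 2 + d x (v j) ^+ 2 - d u (v j) ^+ 2 <= c) ->
  d (v n) x ^+ 2 <=
  b%:R ^+ 2 * m.+1%:R / n.+1%:R + c + (n - m)%:R * (3 * b%:R * e).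
Proof.
move=> Cx Ux eb c0 mn cx; rewrite -(subnK mn) addnK.
elim: (n - m)%N => [|j IHj].
  rewrite add0n mul0r addr0 mulfK ?pnatr_eq0//.
  apply: le_trans (_ : b%:R ^+ 2 <= _); last by rewrite lerDl.
  by rewrite ler_pXn2r ?nnegrE ?ler0n// C_diam//; exact: halpern_in.
have e0 : 0 <= e by exact: le_trans (d_ge0 _ _) Ux.
rewrite addSn; apply: le_trans (halpern_recursion Cx Ux eb (cx _ _)) _.
  by rewrite ltnS leq_addl.
have n2 : (j + m).+2%:R = (j + m).+1%:R + 1 :> R by rewrite natr1.
have n1 : 0 < (j + m).+1%:R :> R by rewrite ltr0n.
have l0 : 0 <= 1 - (j + m).+2%:R^-1 :> R by rewrite subr_ge0 invf_le1 ?ler1n.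
have l1 : 0 <= (j + m).+2%:R^-1 :> R by rewrite invr_ge0.
apply: le_trans (lerD (lerD (ler_wpM2l l0 IHj) (lexx _)) (lexx _)) _.
have E : (1 - (j + m).+2%:R^-1) * (b%:R ^+ 2 * m.+1%:R / (j + m).+1%:R) =
    b%:R ^+ 2 * m.+1%:R / (j + m).+2%:R :> R.
  rewrite n2; move: (j + m).+1%:R n1 m.+1%:R => p p0 q; field.
  by rewrite !gt_eqF//; lra.
rewrite mulrDr mulrDr E -[j.+1%:R]natr1.
have : 0 <= (j + m).+2%:R^-1 * (j%:R * (3 * b%:R * e)) :> R.
  by rewrite !mulr_ge0 ?ler0n.
by move: (j + m).+2%:R^-1 => l; lra.
Qed.

(** The three terms of [halpern_dist_bound] are at most [1/12], [1/48] and [1/12] of [1/(k+1)^2];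
    their sum [3/16] is below [1/4]. *)
Lemma halpern_metastability_bound x k m N F n : C x ->
  d (U x) x <= (36 * b * k.+1 ^ 2 * F.+1)%:R^-1 ->
  (forall j, (m < j)%N ->
     d u x ^+ 2 + d x (v j) ^+ 2 - d u (v j) ^+ 2 <= (48 * k.+1 ^ 2)%:R^-1) ->
  (12 * b ^ 2 * k.+1 ^ 2 * m.+1 <= N.+1)%N -> (N <= n <= F)%N ->
  d (v n) x < (2 * k.+1%:R)^-1.
Proof.
move=> Cx Ux cx mN /andP[Nn nF].
have b0 : 0 < b%:R :> R by rewrite ltr0n.
have K0 : 0 < k.+1%:R :> R by rewrite ltr0n.
have F0 : 0 < F.+1%:R :> R by rewrite ltr0n.
have n0 : 0 < n.+1%:R :> R by rewrite ltr0n.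
have mn : (m <= n)%N by nia.
rewrite -(ltr_pXn2r (n := 2)) ?nnegrE ?invr_ge0 ?mulr_ge0 ?d_ge0 ?ler0n//.
apply: le_lt_trans (halpern_dist_bound Cx Ux _ _ mn cx) _.
- apply: le_trans b_ge1; rewrite invf_le1 ?ltr0n ?ler1n ?muln_gt0 ?b_gt0//.
- by rewrite invr_ge0.
have first_le : b%:R ^+ 2 * m.+1%:R / n.+1%:R <= (12 * k.+1%:R ^+ 2)^-1 :> R.
  rewrite ler_pdivrMr// ler_pdivlMl ?mulr_gt0 ?exprn_gt0//.
  have : (12 * b ^ 2 * k.+1 ^ 2 * m.+1 <= n.+1)%N by exact: leq_trans mN _.
  rewrite -(ler_nat R) !(natrX, natrM); lra.
have last_le : (n - m)%:R * (3 * b%:R * (36 * b * k.+1 ^ 2 * F.+1)%:R^-1) <=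
    (12 * k.+1%:R ^+ 2)^-1 :> R.
  have -> : 3 * b%:R * (36 * b * k.+1 ^ 2 * F.+1)%:R^-1 =
      (12 * k.+1%:R ^+ 2)^-1 / F.+1%:R :> R.
    rewrite !(natrX, natrM).
    move: F.+1%:R F0 k.+1%:R K0 => p p0 q q0; field.
    by rewrite !gt_eqF.
  rewrite mulrCA ler_piMr ?invr_ge0 ?mulr_ge0 ?sqr_ge0//.
  by rewrite ler_pdivrMr// mul1r ler_nat; lia.
rewrite !(natrX, natrM) in last_le *.
have i0 : 0 < k.+1%:R^-1 ^+ 2 :> R by rewrite exprn_gt0 ?invr_gt0.
move: first_le last_le; rewrite !invfM.
move: (k.+1%:R^-1) i0 (_ / n.+1%:R) (_ * (3 * _ * _)) => q q2 s t.
by rewrite exprMn !expr2; lra.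
Qed.

(** All iterates in the interval are close to one [x], whose displacement must be small relative to
    [f (sg m)], while [m] comes with [x]. Iterating [om] breaks the circle: [m] is computed from the
    [i]-th iterate, and the displacement of [x] is controlled by the next one. Here [sg] stands for
    [sigma_]. *)
Lemma halpern_metastability (k : nat) (sg f : nat -> nat) :
  (forall m, 12 * b ^ 2 * k.+1 ^ 2 * m.+1 <= (sg m).+1)%N ->
  exists2 m, (m <= psi_ b (48 * k.+1 ^ 2 - 1)
                (fun m => 36 * b * k.+1 ^ 2 * (f (sg m) + 1) - 1))%N &
  forall i j, (sg m <= i <= f (sg m))%N -> (sg m <= j <= f (sg m))%N ->
    d (v i) (v j) < k.+1%:R^-1.
Proof.
move=> sgP; rewrite /psi_ /r_.
set kk := (48 * k.+1 ^ 2 - 1)%N; set g := fun m => (_ - 1)%N.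
set om := omega_ b _.
have kkE : kk.+1 = (48 * k.+1 ^ 2)%N by rewrite /kk subn1 prednK// muln_gt0.
have om_ge m : (12 * b * m.+1 ^ 2 <= om m)%N by rewrite ltnW// ltnS leq_maxr.
have le_om n : (n <= om n)%N.
  apply: leq_trans (om_ge _); rewrite -[leqLHS]mul1n leq_mul ?muln_gt0 ?b_gt0//.
  by rewrite -mulnn; nia.
have w_le i j : (i <= j)%N -> (iter i om 0 <= iter j om 0)%N.
  elim: j => [|j IHj]; first by rewrite leqn0 => /eqP->.
  rewrite leq_eqVlt => /predU1P[->//|]; rewrite ltnS => /IHj /leq_trans; apply.
  exact: le_om.
have [||i [x [ir Cx Ux nearx]]] :=
  @quantitative_projection kk.+1 (fun i => iter i om 0).
- by [].
- by move=> i; exact: om_ge.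
set M := (12 * b * (iter i om 0).+1 ^ 2)%N in nearx.
(* From rank [m] on, the iterates are moved by at most [1/(M+1)], as [nearx] requires; [psi_] is
   this rank with [i] replaced by its bound. *)
pose m := (16 * b ^ 2 * M.+1 ^ 2 + 8 * b * M.+1)%N.
exists m.
  have ir' : (i <= b ^ 4 * (2 * kk + 1).+1 ^ 2 + b ^ 2)%N.
    by move: ir; rewrite mulnS add2n addn1 => /ltnW.
  have leM : (M.+1 <= 12 * b * (iter (b ^ 4 * (2 * kk + 1).+1 ^ 2 + b ^ 2)
      om 0).+1 ^ 2 + 1)%N.
    by rewrite addn1 ltnS leq_mul2l leq_sqr ltnS w_le ?orbT.
  by apply: leq_add; rewrite leq_mul2l ?leq_sqr leM orbT.
(* [hat_ b g M] is [g m], and [omega_] makes the iterate of index [i.+1] exceed it. *)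
have Ux' : d (U x) x <= (36 * b * k.+1 ^ 2 * (f (sg m)).+1)%:R^-1.
  apply: le_trans Ux _.
  rewrite lef_pV2 ?posrE ?ltr0n ?muln_gt0 ?b_gt0// ler_nat.
  apply: (@leq_trans (g m).+1); last first.
    by rewrite ltnW// ltnS iterS !ltnS /omega_ /gamma_ /hat_ !leq_max leqnn.
  by rewrite /g addn1 subn1; exact: leqSpred.
have dist n : (sg m <= n <= f (sg m))%N -> d (v n) x < (2 * k.+1%:R)^-1.
  move=> nN; apply: halpern_metastability_bound Cx Ux' _ (sgP m) nN.
  move=> j mj; rewrite -kkE; apply: nearx; first exact: halpern_in.
  by apply: halpern_asymptotic_regularity; exact: ltnW.
move=> i1 j1 /dist i1x /dist j1x.
apply: le_lt_trans (d_triangle _ x _) _; rewrite (dC x).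
have -> : k.+1%:R^-1 = (2 * k.+1%:R)^-1 + (2 * k.+1%:R)^-1 :> R.
  have : k.+1%:R != 0 :> R by rewrite pnatr_eq0.
  by move: k.+1%:R => q q0; field.
exact: ltrD.
Qed.

End Halpern.

(** * Monotonicity and growth of [sigma_] *)

Lemma sigma_le (R : realType) b k m n : (m <= n)%N ->
  (sigma_ R b k m <= sigma_ R b k n)%N.
Proof.
move=> mn; rewrite /sigma_ -lez_nat !gez0_abs ?ceil_ge0
  ?(lt_le_trans _ (expR_ge0 _))//.
apply: ceil_le; rewrite ler_expR lerD2r lerD2r ler_nat.
by rewrite geq_max !leq_max mn leqnn orbT.
Qed.

(** The inequality [expR x >= 1 + x] handles the summand [n' + 1], and the rounded-up logarithm
    contributes a factor of at least [A]. *)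
Lemma sigma_ge (R : realType) b k m : (0 < b)%N ->
  (3 * b ^ 2 * k.+1 ^ 2 * m.+1 <= (sigma_ R b k m).+1)%N.
Proof.
move=> b0; rewrite /sigma_; set A := (3 * b ^ 2 * k.+1 ^ 2)%N.
have A0 : 0 < A%:R :> R by rewrite ltr0n !muln_gt0 b0.
apply: leqW; set y := expR _.
have y0 : 0 < y by exact: expR_gt0.
rewrite -(ler_nat R) natr_absz ger0_norm ?ceil_ge0 ?(lt_le_trans _ (ltW y0))//.
apply: le_trans (ceil_ge y).
rewrite natrM mulrC /y expRD; apply: ler_pM => //.
- apply: le_trans (expR_ge1Dx _).
  rewrite -natr1 -[leRHS]addrC -addrA lerD//.
    by rewrite ler_nat leq_max leqnn.
  lra.
- by rewrite -{1}(lnK (x := A%:R)) ?posrE// ler_expR ceil_ge.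
Qed.

(** * Transfer to real and complex Hilbert spaces *)

(** Stewart's identity, the source of [W_CN]. As [theta] fixes the weights, both cross terms carry
    the factor [s * t], for real and complex scalars alike. *)
Lemma dot_convex_combination (K : numFieldType) (theta : K -> K)
  (X : lmodType K) (ip : {dot X for theta}) (s t : K) (x y : X) :
  theta s = s -> theta t = t -> s + t = 1 ->
  ip (s *: x + t *: y) (s *: x + t *: y) =
  s * ip x x + t * ip y y - s * t * ip (x - y) (x - y).
Proof.
move=> sK tK st.
have ipZr a z z' : ip z (a *: z') = theta a * ip z z' by exact: linearZr_LR.
have ipZl a z z' : ip (a *: z) z' = a * ip z z' by exact: linearZl_LR.
rewrite !(linearDl, linearDr, linearNl, linearNr) /= !ipZl !ipZr sK tK.
have -> : s = 1 - t by rewrite -st addrK.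
by ring.
Qed.

(** [iota] embeds the reals into the scalars and reaches every nonnegative one, so norms pull back
    to [R], where the metric argument runs. *)
Lemma halpern_metastability_dot (R : realType) (K : numFieldType)
  (iota : {rmorphism R -> K}) (iota_le : {mono iota : x y / x <= y})
  (iota_ge0 : forall z : K, 0 <= z -> exists a, z = iota a)
  (theta : K -> K) (theta_iota : forall a, theta (iota a) = iota a)
  (X : normedModType K) (ip : {dot X for theta})
  (norm_ip : forall x : X, `|x| ^+ 2 = ip x x)
  (C : set X) (C_convex : convex_set C) (U : X -> X) (U_C : set_fun C C U)
  (U_nonexpansive : nonexpansive_on C U) (u : X) (uC : C u)
  (b : nat) (b_gt0 : (0 < b)%N)
  (C_diam : forall x y, C x -> C y -> `|x - y| <= b%:R)
  (k : nat) (f : nat -> nat) :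
  exists N : nat, (N <= phi_ R b k f)%N /\
    forall i j : nat, (N <= i <= f N)%N -> (N <= j <= f N)%N ->
      `|halpern U u i - halpern U u j| < 1 / k.+1%:R.
Proof.
have iota_lt : {mono iota : x y / x < y} by exact: leW_mono.
have [nrm nrmE] : {nrm : X -> R & forall x, `|x| = iota (nrm x)}.
  by apply: (@choice _ _ (fun x a => `|x| = iota a)) => x; exact: iota_ge0.
pose d x y := nrm (x - y).
pose W (t : R) (x y : X) := iota (1 - t) *: x + iota t *: y.
have dE x y : iota (d x y) = `|x - y| by rewrite nrmE.
have d_ge0 x y : 0 <= d x y by rewrite -iota_le rmorph0 dE.
have d_xx x : d x x = 0.
  by apply: (fmorph_inj iota); rewrite dE subrr normr0 rmorph0.
have dC x y : d x y = d y x by apply: (fmorph_inj iota); rewrite !dE distrC.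
have d_triangle x y z : d x z <= d x y + d y z.
  by rewrite -iota_le rmorphD !dE ler_distD.
have W_CN z (t : R) x y : 0 <= t <= 1 ->
    d z (W t x y) ^+ 2 <=
    (1 - t) * d z x ^+ 2 + t * d z y ^+ 2 - t * (1 - t) * d x y ^+ 2.
  move=> _; rewrite -iota_le (dC x) [t * (1 - t)]mulrC.
  suff -> : iota (d z (W t x y) ^+ 2) = iota ((1 - t) * d z x ^+ 2
      + t * d z y ^+ 2 - (1 - t) * t * d y x ^+ 2) by [].
  rewrite rmorphB rmorphD !(rmorphXn, rmorphM) /= !dE !norm_ip.
  have -> : z - W t x y = iota (1 - t) *: (z - x) + iota t *: (z - y).
    rewrite /W !scalerBr addrACA -scalerDl -rmorphD subrK rmorph1 scale1r.
    by rewrite opprD.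
  have -> : y - x = (z - x) - (z - y) by rewrite opprB [RHS]addrC addrA subrK.
  by rewrite dot_convex_combination// -rmorphD subrK rmorph1.
have W_contract (t : R) x y z : 0 <= t <= 1 ->
    d (W t x z) (W t y z) <= (1 - t) * d x y.
  move=> /andP[_ t1]; rewrite -iota_le rmorphM !dE /W opprD addrACA.
  rewrite subrr addr0 -scalerBr normrZ.
  by rewrite ger0_norm// -(rmorph0 iota) iota_le subr_ge0.
have W_lipschitz (s t : R) x y : 0 <= s <= t -> t <= 1 ->
    d (W s x y) (W t x y) <= (t - s) * d x y.
  move=> /andP[_ st] _; rewrite -iota_le rmorphM !dE /W.
  have -> : iota (1 - s) *: x + iota s *: y - (iota (1 - t) *: x + iota t *: y)
      = iota (t - s) *: (x - y).
    rewrite opprD addrACA -!scalerBl -!rmorphB scalerBr.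
    have -> : 1 - s - (1 - t) = t - s by ring.
    by rewrite -scaleNr -rmorphN opprB.
  by rewrite normrZ ger0_norm// -(rmorph0 iota) iota_le subr_ge0.
have C_W (t : R) x y : 0 <= t <= 1 -> C x -> C y -> C (W t x y).
  move=> /andP[t0 t1] Cx Cy.
  have it0 : 0 <= iota t by rewrite -(rmorph0 iota) iota_le.
  have it1 : iota t <= 1 by rewrite -(rmorph1 iota) iota_le.
  (* [conv] weights its first point by the parameter, [W] its second; hence the swap of [x] and
     [y]. *)
  have /= := C_convex y x (Itv01 it0 it1) (mem_set Cy) (mem_set Cx).
  rewrite inE /conv /= /W rmorphB rmorph1 addrC; exact.
have d_diam x y : C x -> C y -> d x y <= b%:R.
  by move=> Cx Cy; rewrite -iota_le rmorph_nat dE; exact: C_diam.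
have d_nonexp x y : C x -> C y -> d (U x) (U y) <= d x y.
  by move=> Cx Cy; rewrite -iota_le !dE; exact: U_nonexpansive.
have vS n : halpern U u n.+1 = W n.+2%:R^-1 (U (halpern U u n)) u.
  rewrite /= /halpern_lambda /W rmorphB rmorph1 fmorphV rmorph_nat.
  by rewrite div1r addrC.
(* The argument [2k+1] of [sigma_] produces the constant: [3 * (2k+2)^2 = 12 * (k+1)^2]. *)
have sgP m : (12 * b ^ 2 * k.+1 ^ 2 * m.+1 <= (sigma_ R b (2 * k + 1) m).+1)%N.
  apply: leq_trans (sigma_ge _ _ _ b_gt0); rewrite leq_mul2r; apply/orP; right.
  by nia.
have [m mpsi mf] := halpern_metastability d_ge0 d_xx dC d_triangle W_CN
  W_contract W_lipschitz C_W d_diam U_C d_nonexp b_gt0 (erefl u) vS uC f sgP.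
exists (sigma_ R b (2 * k + 1) m); split; first exact: sigma_le.
move=> i j iN jN.
by rewrite -dE div1r -(rmorph_nat iota) -fmorphV iota_lt; exact: mf.
Qed.

Theorem theorem5p7 (R : realType) (s : scalar_kind)
  (X : completeNormedModType (scalars R s))
  (ip : {dot X for @scalars_conj R s})
  (norm_ip : forall x : X, `|x| ^+ 2 = ip x x)
  (C : set X) (C_nonempty : C !=set0) (C_closed : closed C)
  (C_convex : convex_set C) (C_bounded : bounded_set C)
  (U : X -> X) (U_C : set_fun C C U) (U_nonexpansive : nonexpansive_on C U)
  (u : X) (uC : C u)
  (b : nat) (b_ge1 : (1 <= b)%N)
  (C_diam : forall x y, C x -> C y -> `|x - y| <= b%:R) :
  forall (k : nat) (f : nat -> nat), {homo f : m n / (m <= n)%N} ->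
  exists N : nat, (N <= phi_ R b k f)%N /\
    forall i j : nat, (N <= i <= f N)%N -> (N <= j <= f N)%N ->
      `|halpern U u i - halpern U u j| < 1 / k.+1%:R.
Proof.
move=> k f _; case: s X ip norm_ip C C_nonempty C_closed C_convex C_bounded U
  U_C U_nonexpansive u uC C_diam => X ip norm_ip C _ _ C_convex _ U U_C
  U_nonexpansive u uC C_diam.
- apply: (@halpern_metastability_dot R R idfun _ _ idfun _ X ip norm_ip C)
    => //.
  by move=> z _; exists z.
- apply: (@halpern_metastability_dot R R[i]%C (real_complex R) _ _
    (@conjc R) _ X ip norm_ip C) => //.
  + exact: lecR.
  + by move=> z z0; exists (complex.Re z); apply/esym/RRe_real/ger0_real.
  + exact: conjc_real.
Qed.
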